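(* Let $F$ be a field in which $2$ is invertible, and let $(V,B)$ be a formed space over $F$ of dimension $3$. Then the Kingdon algebra $K(V,B)$ is isomorphic to an eight-dimensional Cayley-Dickson algebra over $F$.
   Context: Algebras over $F$ are unital but not necessarily associative. A formed space $(V,B)$ is a finite-dimensional $F$-vector space $V$ with a symmetric bilinear form $B$ (possibly degenerate). An algebra is alternative if $x(xy)=(xx)y$ and $y(xx)=(yx)x$ for all elements $x,y$. $\mathrm{Alt}[V]$ denotes the free (unital) alternative $F$-algebra over $V$: it is alternative, contains $V$ as a subspace and $F=F1$, and each linear map from $V$ to an alternative $F$-algebra $A$ extends uniquely to an $F$-algebra homomorphism $\mathrm{Alt}[V]\to A$. The Kingdon algebra is $K(V,B)=\mathrm{Alt}[V]/I_B$, where $I_B$ is the two-sided ideal generated by all elements $uv+vu-B(u,v)\cdot 1$ and $(uv)w-w(vu)$ with $u,v,w\in V$. An $F$-algebra $A$, in which the subalgebra $F[a]$ is commutative for each $a\in A$, is symmetric quadratic if it has an involutory ($F$-linear) anti-automorphism $a\mapsto a^*$ (conjugation), restricting to an automorphism of $F[a]$ for each $a\in A$, such that $(X-a)(X-a^* )=X^2-T(a)X+N(a)\in F[X]$, i.e. $T(a)=a+a^*\in F$ and $N(a)=aa^*\in F$, with $T(1)=2$ and $N(1)=1$. The field $F$ itself is symmetric quadratic with $a^*=a$. Given a symmetric quadratic $F$-algebra $A$ and $\gamma\in F$, the Cayley-Dickson process yields the algebra $A^\gamma$ on the vector space $A^2$ with multiplication $(a,b)\cdot(c,d)=(ac+\gamma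 d^*b,\ da+bc^* )$; with conjugation $(a,b)^*=(a^*,-b)$ it is again symmetric quadratic, so that the process may be iterated (starting from $F$). The resulting algebras are called Cayley-Dickson algebras; the parameters $\gamma$ are allowed to be $0$. *)

(* Defs.v *)
From HB Require Import structures.
From mathcomp Require Import all_boot all_algebra.
From mathcomp Require Import boolp.

Set Implicit Arguments.
Unset Strict Implicit.
Unset Printing Implicit Defensive.

Import GRing.Theory.
Local Open Scope ring_scope.
Local Open Scope quotient_scope.

HB.mixin Record Lmodule_isNAAlgebra (F : fieldType) A of GRing.Lmodule F A := {
  naone : A;
  namul : A -> A -> A;
  namul1l : left_id naone namul;
  namul1r : right_id naone namul;
  namulDl : left_distributive namul +%R;
  namulDr : right_distributive namul +%R;
  namulZl : forall (c : F) x y, namul (c *: x) y = c *: namul x y;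
  namulZr : forall (c : F) x y, namul x (c *: y) = c *: namul x y
}.

#[short(type="naAlgType")]
HB.structure Definition NAAlgebra (F : fieldType) :=
  {A of Lmodule_isNAAlgebra F A & GRing.Lmodule F A}.

Notation "x ** y" := (namul x y) (at level 40, left associativity) : ring_scope.
Notation "\1" := naone (at level 0) : ring_scope.

Section NAAlgebraTheory.
Variables (F : fieldType) (A : naAlgType F).
Implicit Types x y z : A.

Lemma namul0l x : 0 ** x = 0.
Proof. by rewrite -(scale0r (0 : A)) namulZl !scale0r. Qed.

Lemma namul0r x : x ** 0 = 0.
Proof. by rewrite -(scale0r (0 : A)) namulZr !scale0r. Qed.

Lemma namulNl x y : (- x) ** y = - (x ** y).
Proof. by rewrite -!scaleN1r namulZl. Qed.

Lemma namulNr x y : x ** (- y) = - (x ** y).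
Proof. by rewrite -!scaleN1r namulZr. Qed.

Lemma namulBl x y z : (x - y) ** z = x ** z - y ** z.
Proof. by rewrite namulDl namulNl. Qed.

Lemma namulBr x y z : x ** (y - z) = x ** y - x ** z.
Proof. by rewrite namulDr namulNr. Qed.

End NAAlgebraTheory.

Definition na_morphism (F : fieldType) (A A' : naAlgType F) (f : A -> A') :=
  f \1 = \1 /\ {morph f : x y / x ** y}.

Definition na_isomorphic (F : fieldType) (A A' : naAlgType F) :=
  exists f : {linear A -> A'}, na_morphism f /\ bijective f.

Definition alternative (F : fieldType) (A : naAlgType F) :=
  forall x y : A, x ** (x ** y) = (x ** x) ** y /\ y ** (x ** x) = (y ** x) ** x.

Definition subalgebra (F : fieldType) (A : naAlgType F) (S : A -> Prop) :=
  [/\ S \1,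
      forall x y, S x -> S y -> S (x + y),
      forall (c : F) x, S x -> S (c *: x) &
      forall x y, S x -> S y -> S (x ** y)].

Definition gen_subalgebra (F : fieldType) (A : naAlgType F) (a x : A) :=
  forall S : A -> Prop, subalgebra S -> S a -> S x.

Definition two_sided_ideal (F : fieldType) (A : naAlgType F) (J : A -> Prop) :=
  [/\ J 0,
      forall x y, J x -> J y -> J (x + y),
      forall (c : F) x, J x -> J (c *: x),
      forall a x, J x -> J (a ** x) &
      forall a x, J x -> J (x ** a)].

Definition gen_ideal (F : fieldType) (A : naAlgType F) (S : A -> Prop) :
    {pred A} :=
  fun x => `[< forall J : A -> Prop,
                 two_sided_ideal J -> (forall s, S s -> J s) -> J x >].

Section Quotient.
Variables (F : fieldType) (A : naAlgType F) (S : A -> Prop).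
Local Notation I := (gen_ideal S).

Lemma gen_ideal_gen s : S s -> s \in I.
Proof. by move=> Ss; apply/asboolP => J _; apply. Qed.

Lemma gen_idealP : two_sided_ideal (fun x => x \in I).
Proof.
split.
- by apply/asboolP=> J [].
- move=> x y /asboolP Ix /asboolP Iy; apply/asboolP => J HJ SJ.
  by have [_ JD _ _ _] := HJ; apply: JD; [apply: Ix | apply: Iy].
- move=> c x /asboolP Ix; apply/asboolP => J HJ SJ.
  by have [_ _ JZ _ _] := HJ; apply: JZ; apply: Ix.
- move=> a x /asboolP Ix; apply/asboolP => J HJ SJ.
  by have [_ _ _ JM _] := HJ; apply: JM; apply: Ix.
- move=> a x /asboolP Ix; apply/asboolP => J HJ SJ.
  by have [_ _ _ _ JM] := HJ; apply: JM; apply: Ix.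
Qed.

Lemma gen_ideal_min (J : A -> Prop) :
  two_sided_ideal J -> (forall s, S s -> J s) -> forall x, x \in I -> J x.
Proof. by move=> HJ SJ x /asboolP; apply. Qed.

Lemma gen_ideal_zmod_closed : zmod_closed I.
Proof.
have [I0 ID IZ _ _] := gen_idealP; split=> // x y Ix Iy.
by apply: ID => //; rewrite -scaleN1r; apply: IZ.
Qed.

HB.instance Definition _ := GRing.isZmodClosed.Build A I gen_ideal_zmod_closed.

Definition na_quot : Type := Quotient.quot I.
HB.instance Definition _ := GRing.Zmodule.on na_quot.

Definition quot_pi (x : A) : na_quot := \pi_(Quotient.quot I) x.
Definition quot_repr (x : na_quot) : A := repr (x : Quotient.quot I).

Lemma quot_reprK : cancel quot_repr quot_pi.
Proof. exact: reprK. Qed.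

Lemma quot_piP x y : quot_pi x = quot_pi y <-> x - y \in I.
Proof. by rewrite Quotient.idealrBE; split=> [E|/eqP //]; apply/eqP. Qed.

Lemma quot_piK x : quot_repr (quot_pi x) - x \in I.
Proof. by apply/quot_piP; rewrite quot_reprK. Qed.

Lemma quot_pi_is_zmod_morphism : zmod_morphism quot_pi.
Proof.
by move=> x y; rewrite /quot_pi (Quotient.pi_add I x (- y)) (Quotient.pi_opp I).
Qed.

Definition quot_scale (c : F) (x : na_quot) := quot_pi (c *: quot_repr x).
Definition quot_mul (x y : na_quot) := quot_pi (quot_repr x ** quot_repr y).

Lemma quot_piZ c x : quot_scale c (quot_pi x) = quot_pi (c *: x).
Proof.
have [_ _ IZ _ _] := gen_idealP; apply/quot_piP.
by rewrite -scalerBr; apply/IZ/quot_piK.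
Qed.

Lemma quot_piM x y : quot_mul (quot_pi x) (quot_pi y) = quot_pi (x ** y).
Proof.
have [_ ID _ IMl IMr] := gen_idealP; apply/quot_piP.
rewrite -(subrK (x ** quot_repr (quot_pi y)) (quot_repr _ ** _)) -addrA.
rewrite -namulBl -namulBr; apply: ID.
- exact/IMr/quot_piK.
- exact/IMl/quot_piK.
Qed.

Lemma quot_piD x y : quot_pi (x + y) = quot_pi x + quot_pi y.
Proof. exact: (Quotient.pi_add I x y). Qed.

Lemma quot_scaleA a b v :
  quot_scale a (quot_scale b v) = quot_scale (a * b) v.
Proof. by rewrite -(quot_reprK v) !quot_piZ scalerA. Qed.

Lemma quot_scale1 : left_id 1 quot_scale.
Proof. by move=> v; rewrite -(quot_reprK v) !quot_piZ scale1r. Qed.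

Lemma quot_scaleDr : right_distributive quot_scale +%R.
Proof.
move=> c u v; rewrite -(quot_reprK u) -(quot_reprK v).
by rewrite -quot_piD !quot_piZ -quot_piD scalerDr.
Qed.

Lemma quot_scaleDl v : {morph quot_scale^~ v : a b / a + b}.
Proof.
by move=> a b; rewrite -(quot_reprK v) !quot_piZ -quot_piD scalerDl.
Qed.

HB.instance Definition _ := GRing.Zmodule_isLmodule.Build F na_quot
  quot_scaleA quot_scale1 quot_scaleDr quot_scaleDl.

Lemma quot_mul1l : left_id (quot_pi \1) quot_mul.
Proof. by move=> x; rewrite -(quot_reprK x) quot_piM namul1l. Qed.

Lemma quot_mul1r : right_id (quot_pi \1) quot_mul.
Proof. by move=> x; rewrite -(quot_reprK x) quot_piM namul1r. Qed.

Lemma quot_mulDl : left_distributive quot_mul +%R.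
Proof.
move=> x y z; rewrite -(quot_reprK x) -(quot_reprK y) -(quot_reprK z).
by rewrite -quot_piD !quot_piM -quot_piD namulDl.
Qed.

Lemma quot_mulDr : right_distributive quot_mul +%R.
Proof.
move=> x y z; rewrite -(quot_reprK x) -(quot_reprK y) -(quot_reprK z).
by rewrite -quot_piD !quot_piM -quot_piD namulDr.
Qed.

Lemma quot_mulZl (c : F) (x y : na_quot) :
  quot_mul (c *: x) y = c *: quot_mul x y.
Proof.
rewrite -(quot_reprK x) -(quot_reprK y) quot_piM.
by rewrite /GRing.scale /= !quot_piZ quot_piM namulZl.
Qed.

Lemma quot_mulZr (c : F) (x y : na_quot) :
  quot_mul x (c *: y) = c *: quot_mul x y.
Proof.
rewrite -(quot_reprK x) -(quot_reprK y) quot_piM.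
by rewrite /GRing.scale /= !quot_piZ quot_piM namulZr.
Qed.

HB.instance Definition _ := Lmodule_isNAAlgebra.Build F na_quot
  quot_mul1l quot_mul1r quot_mulDl quot_mulDr quot_mulZl quot_mulZr.

Lemma quot_pi_is_scalable : scalable quot_pi.
Proof. by move=> c x; rewrite -quot_piZ. Qed.

HB.instance Definition _ :=
  GRing.isZmodMorphism.Build A na_quot quot_pi quot_pi_is_zmod_morphism.
HB.instance Definition _ :=
  GRing.isScalable.Build F A na_quot *:%R quot_pi quot_pi_is_scalable.

Lemma quot_pi_morphism : na_morphism quot_pi.
Proof. by split=> // x y; rewrite -quot_piM. Qed.

Lemma quot_pi_surj (x : na_quot) : exists a, quot_pi a = x.
Proof. by exists (quot_repr x); rewrite quot_reprK. Qed.

Lemma quot_pi_eq0 x : (quot_pi x == 0) = (x \in I).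
Proof.
rewrite -(raddf0 quot_pi); apply/eqP/idP => [/quot_piP|Ix].
  by rewrite subr0.
by apply/quot_piP; rewrite subr0.
Qed.

End Quotient.

(* Alt[V] is built as the formal algebra expressions in the elements of V,    *)
(* modulo the congruence generated by the axioms of unital alternative        *)
(* F-algebras and by the linearity of the inclusion of V. Its universal       *)
(* property is Alt_universal, and alt_in_inj embeds F1 and V in it.           *)

Section Free.
Variables (F : fieldType) (V : lmodType F).

Inductive alt_term : Type :=
| TVar of V
| TZero
| TOne
| TAdd of alt_term & alt_term
| TScale of F & alt_term
| TMul of alt_term & alt_term.

HB.instance Definition _ := gen_eqMixin alt_term.
HB.instance Definition _ := gen_choiceMixin alt_term.

Inductive alt_eq : alt_term -> alt_term -> Prop :=
| alt_refl x : alt_eq x x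
| alt_sym x y : alt_eq x y -> alt_eq y x
| alt_trans y x z : alt_eq x y -> alt_eq y z -> alt_eq x z
| alt_congD x x' y y' :
    alt_eq x x' -> alt_eq y y' -> alt_eq (TAdd x y) (TAdd x' y')
| alt_congZ c x x' : alt_eq x x' -> alt_eq (TScale c x) (TScale c x')
| alt_congM x x' y y' :
    alt_eq x x' -> alt_eq y y' -> alt_eq (TMul x y) (TMul x' y')
| alt_addA x y z : alt_eq (TAdd x (TAdd y z)) (TAdd (TAdd x y) z)
| alt_addC x y : alt_eq (TAdd x y) (TAdd y x)
| alt_add0 x : alt_eq (TAdd TZero x) x
| alt_addN x : alt_eq (TAdd (TScale (-1) x) x) TZero
| alt_scaleA a b x : alt_eq (TScale a (TScale b x)) (TScale (a * b) x)
| alt_scale1 x : alt_eq (TScale 1 x) x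
| alt_scaleDr a x y :
    alt_eq (TScale a (TAdd x y)) (TAdd (TScale a x) (TScale a y))
| alt_scaleDl a b x :
    alt_eq (TScale (a + b) x) (TAdd (TScale a x) (TScale b x))
| alt_mul1l x : alt_eq (TMul TOne x) x
| alt_mul1r x : alt_eq (TMul x TOne) x
| alt_mulDl x y z : alt_eq (TMul (TAdd x y) z) (TAdd (TMul x z) (TMul y z))
| alt_mulDr x y z : alt_eq (TMul x (TAdd y z)) (TAdd (TMul x y) (TMul x z))
| alt_mulZl c x y : alt_eq (TMul (TScale c x) y) (TScale c (TMul x y))
| alt_mulZr c x y : alt_eq (TMul x (TScale c y)) (TScale c (TMul x y))
| alt_altl x y : alt_eq (TMul x (TMul x y)) (TMul (TMul x x) y)
| alt_altr x y : alt_eq (TMul y (TMul x x)) (TMul (TMul y x) x)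
| alt_varD u v : alt_eq (TVar (u + v)) (TAdd (TVar u) (TVar v))
| alt_varZ c v : alt_eq (TVar (c *: v)) (TScale c (TVar v)).

Definition alt_eqb (x y : alt_term) : bool := `[< alt_eq x y >].

Lemma alt_eqb_equiv : equiv_class_of alt_eqb.
Proof.
split=> [x|x y|y x z]; first exact/asboolP/alt_refl.
  by apply/asboolP/asboolP; apply: alt_sym.
by move=> /asboolP xy /asboolP yz; apply/asboolP/(alt_trans xy yz).
Qed.

Canonical alt_eqb_equivRel := EquivRelPack alt_eqb_equiv.

Definition Alt : Type := {eq_quot alt_eqb}.
HB.instance Definition _ := Choice.on Alt.

Definition alt_class (x : alt_term) : Alt := \pi_({eq_quot alt_eqb}) x.
Definition alt_repr (x : Alt) : alt_term := repr (x : {eq_quot alt_eqb}).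

Lemma alt_reprK : cancel alt_repr alt_class.
Proof. exact: reprK. Qed.

Lemma alt_classP x y : alt_class x = alt_class y <-> alt_eq x y.
Proof.
split=> [/eqmodP/asboolP //|xy].
exact/eqmodP/asboolP.
Qed.

Lemma alt_classK x : alt_eq (alt_repr (alt_class x)) x.
Proof. by apply/alt_classP; rewrite alt_reprK. Qed.

Definition alt_add (x y : Alt) := alt_class (TAdd (alt_repr x) (alt_repr y)).
Definition alt_scale c (x : Alt) := alt_class (TScale c (alt_repr x)).
Definition alt_mul (x y : Alt) := alt_class (TMul (alt_repr x) (alt_repr y)).

Lemma alt_classD x y : alt_add (alt_class x) (alt_class y) = alt_class (TAdd x y).
Proof. by apply/alt_classP/alt_congD; apply: alt_classK. Qed.

Lemma alt_classZ c x : alt_scale c (alt_class x) = alt_class (TScale c x).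
Proof. by apply/alt_classP/alt_congZ/alt_classK. Qed.

Lemma alt_classM x y : alt_mul (alt_class x) (alt_class y) = alt_class (TMul x y).
Proof. by apply/alt_classP/alt_congM; apply: alt_classK. Qed.

Local Ltac lift2 :=
  repeat match goal with x : Alt |- _ => rewrite -(alt_reprK x);
    move: (alt_repr x) => {}x end;
  rewrite ?(alt_classD, alt_classZ, alt_classM); apply/alt_classP.

Fact alt_addA' : associative alt_add.
Proof. by move=> x y z; lift2; apply: alt_addA. Qed.
Fact alt_addC' : commutative alt_add.
Proof. by move=> x y; lift2; apply: alt_addC. Qed.
Fact alt_add0' : left_id (alt_class TZero) alt_add.
Proof. by move=> x; lift2; apply: alt_add0. Qed.
Fact alt_addN' : left_inverse (alt_class TZero) (alt_scale (-1)) alt_add.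
Proof. by move=> x; lift2; apply: alt_addN. Qed.

HB.instance Definition _ :=
  GRing.isZmodule.Build Alt alt_addA' alt_addC' alt_add0' alt_addN'.

Fact alt_scaleA' a b x : alt_scale a (alt_scale b x) = alt_scale (a * b) x.
Proof. by lift2; apply: alt_scaleA. Qed.
Fact alt_scale1' : left_id 1 alt_scale.
Proof. by move=> x; lift2; apply: alt_scale1. Qed.
Fact alt_scaleDr' : right_distributive alt_scale alt_add.
Proof. by move=> c x y; lift2; apply: alt_scaleDr. Qed.
Fact alt_scaleDl' x a b :
  alt_scale (a + b) x = alt_add (alt_scale a x) (alt_scale b x).
Proof. by lift2; apply: alt_scaleDl. Qed.

HB.instance Definition _ := GRing.Zmodule_isLmodule.Build F Alt
  alt_scaleA' alt_scale1' alt_scaleDr' alt_scaleDl'.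

Fact alt_mul1l' : left_id (alt_class TOne) alt_mul.
Proof. by move=> x; lift2; apply: alt_mul1l. Qed.
Fact alt_mul1r' : right_id (alt_class TOne) alt_mul.
Proof. by move=> x; lift2; apply: alt_mul1r. Qed.
Fact alt_mulDl' : left_distributive alt_mul alt_add.
Proof. by move=> x y z; lift2; apply: alt_mulDl. Qed.
Fact alt_mulDr' : right_distributive alt_mul alt_add.
Proof. by move=> x y z; lift2; apply: alt_mulDr. Qed.
Fact alt_mulZl' c x y : alt_mul (alt_scale c x) y = alt_scale c (alt_mul x y).
Proof. by lift2; apply: alt_mulZl. Qed.
Fact alt_mulZr' c x y : alt_mul x (alt_scale c y) = alt_scale c (alt_mul x y).
Proof. by lift2; apply: alt_mulZr. Qed.

HB.instance Definition _ := Lmodule_isNAAlgebra.Build F Alt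
  alt_mul1l' alt_mul1r' alt_mulDl' alt_mulDr' alt_mulZl' alt_mulZr'.

Fact alt_class_add x y : alt_class (TAdd x y) = alt_class x + alt_class y.
Proof. by rewrite -alt_classD. Qed.
Fact alt_class_scale c x : alt_class (TScale c x) = c *: alt_class x.
Proof. by rewrite -alt_classZ. Qed.
Fact alt_class_mul x y : alt_class (TMul x y) = alt_class x ** alt_class y.
Proof. by rewrite -alt_classM. Qed.

Definition alt_in (v : V) : Alt := alt_class (TVar v).

Fact alt_in_is_linear : linear alt_in.
Proof.
move=> c u v; rewrite /alt_in -alt_class_scale -alt_class_add; apply/alt_classP.
apply: alt_trans (alt_varD _ _) _; apply: alt_congD; last exact: alt_refl.
exact: alt_varZ.
Qed.

HB.instance Definition _ := GRing.isLinear.Build F V Alt *:%R alt_in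
  alt_in_is_linear.

Lemma Alt_alternative : alternative Alt.
Proof.
move=> x y; rewrite -(alt_reprK x) -(alt_reprK y).
move: (alt_repr x) (alt_repr y) => {}x {}y.
rewrite -(alt_class_mul x y) -(alt_class_mul x x) -(alt_class_mul y x).
rewrite -(alt_class_mul x) -(alt_class_mul _ y) -(alt_class_mul y).
rewrite -(alt_class_mul _ x).
by split; apply/alt_classP; [apply: alt_altl | apply: alt_altr].
Qed.

Section Lift.
Variables (A : naAlgType F) (altA : alternative A) (f : {linear V -> A}).

Fixpoint alt_eval (t : alt_term) : A :=
  match t with
  | TVar v => f v
  | TZero => 0
  | TOne => \1
  | TAdd x y => alt_eval x + alt_eval y
  | TScale c x => c *: alt_eval x
  | TMul x y => alt_eval x ** alt_eval y
  end.

Lemma alt_eval_eq x y : alt_eq x y -> alt_eval x = alt_eval y.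
Proof.
elim=> //=.
- by move=> {}y {}x z _ -> _ ->.
- by move=> ? ? ? ? _ -> _ ->.
- by move=> ? ? ? _ ->.
- by move=> ? ? ? ? _ -> _ ->.
- by move=> *; rewrite addrA.
- by move=> *; rewrite addrC.
- by move=> *; rewrite add0r.
- by move=> *; rewrite scaleN1r addNr.
- by move=> *; rewrite scalerA.
- by move=> *; rewrite scale1r.
- by move=> *; rewrite scalerDr.
- by move=> *; rewrite scalerDl.
- by move=> *; rewrite namul1l.
- by move=> *; rewrite namul1r.
- by move=> *; rewrite namulDl.
- by move=> *; rewrite namulDr.
- by move=> *; rewrite namulZl.
- by move=> *; rewrite namulZr.
- by move=> u v; case: (altA (alt_eval u) (alt_eval v)).
- by move=> u v; case: (altA (alt_eval u) (alt_eval v)).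
- by move=> *; rewrite linearD.
- by move=> *; rewrite linearZ.
Qed.

Definition alt_lift (x : Alt) : A := alt_eval (alt_repr x).

Lemma alt_lift_class t : alt_lift (alt_class t) = alt_eval t.
Proof. exact/alt_eval_eq/alt_classK. Qed.

Fact alt_lift_is_linear : linear alt_lift.
Proof.
move=> c x y; rewrite -(alt_reprK x) -(alt_reprK y).
by rewrite -alt_class_scale -alt_class_add !alt_lift_class.
Qed.

Lemma alt_lift_morphism : na_morphism alt_lift.
Proof.
split=> [|x y]; first exact: alt_lift_class.
rewrite -(alt_reprK x) -(alt_reprK y).
by rewrite -alt_class_mul !alt_lift_class.
Qed.

Lemma alt_lift_in v : alt_lift (alt_in v) = f v.
Proof. exact: alt_lift_class. Qed.

Lemma alt_lift_uniq (g : {linear Alt -> A}) :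
  na_morphism g -> (forall v, g (alt_in v) = f v) -> g =1 alt_lift.
Proof.
move=> [g1 gM] gV x; rewrite -(alt_reprK x) alt_lift_class.
elim: (alt_repr x) => [v||||c t IH|] //=.
- exact: gV.
- exact: (linear0 g).
- by move=> t IHt u IHu; rewrite alt_class_add linearD IHt IHu.
- by rewrite alt_class_scale linearZ IH.
- by move=> t IHt u IHu; rewrite alt_class_mul gM IHt IHu.
Qed.

End Lift.

Theorem Alt_universal (A : naAlgType F) (f : {linear V -> A}) :
  alternative A ->
  exists g : {linear Alt -> A},
    [/\ na_morphism g, forall v, g (alt_in v) = f v &
        forall h : {linear Alt -> A},
          na_morphism h -> (forall v, h (alt_in v) = f v) -> h =1 g].
Proof.
move=> altA; pose g : {linear Alt -> A} := HB.pack (alt_lift f)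
  (GRing.isLinear.Build F Alt A *:%R _ (alt_lift_is_linear altA f)).
exists g; split.
- exact: alt_lift_morphism.
- exact: alt_lift_in.
- exact: alt_lift_uniq.
Qed.

End Free.

(* The trivial extension of F by V witnesses that F1 and V embed in Alt[V],   *)
(* with F1 :&: V = 0.                                                         *)

Definition triv_ext (F : fieldType) (V : lmodType F) : Type := (F^o * V)%type.

Section TrivialExtension.
Variables (F : fieldType) (V : lmodType F).
Local Notation T := (triv_ext V).

HB.instance Definition _ := GRing.Lmodule.copy T (F^o * V)%type.

Definition triv_mul (x y : T) : T := (x.1 * y.1, x.1 *: y.2 + y.1 *: x.2).

Fact triv_mul1l : left_id ((1, 0) : T) triv_mul.
Proof. by move=> [a u]; rewrite /triv_mul /= mul1r scale1r scaler0 addr0. Qed.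
Fact triv_mul1r : right_id ((1, 0) : T) triv_mul.
Proof. by move=> [a u]; rewrite /triv_mul /= mulr1 scale1r scaler0 add0r. Qed.
Fact triv_mulDl : left_distributive triv_mul +%R.
Proof.
move=> [a u] [b v] [c w]; congr (_, _) => /=; first by rewrite mulrDl.
by rewrite scalerDl scalerDr addrACA.
Qed.
Fact triv_mulDr : right_distributive triv_mul +%R.
Proof.
move=> [a u] [b v] [c w]; congr (_, _) => /=; first by rewrite mulrDr.
by rewrite scalerDl scalerDr addrACA.
Qed.
Fact triv_mulZl (k : F) (x y : T) : triv_mul (k *: x) y = k *: triv_mul x y.
Proof.
case: x y => [a u] [b v]; congr (_, _) => /=; first by rewrite -scalerAl.
by rewrite scalerDr !scalerA (mulrC b k).
Qed.
Fact triv_mulZr (k : F) (x y : T) : triv_mul x (k *: y) = k *: triv_mul x y.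
Proof.
case: x y => [a u] [b v]; congr (_, _) => /=; first by rewrite -scalerAr.
by rewrite scalerDr !scalerA (mulrC a k).
Qed.

HB.instance Definition _ := Lmodule_isNAAlgebra.Build F T
  triv_mul1l triv_mul1r triv_mulDl triv_mulDr triv_mulZl triv_mulZr.

Lemma triv_ext_alternative : alternative T.
Proof.
move=> [a u] [b v]; split; congr (_, _) => /=; rewrite ?mulrA //.
  by rewrite !scalerDr !scalerA -!addrA (mulrC b a) -!scalerDl.
by rewrite !scalerDr !scalerA -!addrA (mulrC a b) addrA addrC addrA.
Qed.

Definition triv_in (v : V) : T := (0, v).

Fact triv_in_is_linear : linear triv_in.
Proof. by move=> c u v; congr (_, _); rewrite /= scaler0 addr0. Qed.

HB.instance Definition _ := GRing.isLinear.Build F V T *:%R triv_in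
  triv_in_is_linear.

Lemma alt_in_inj (c d : F) (u v : V) :
  c *: \1 + alt_in u = d *: \1 + alt_in v -> c = d /\ u = v.
Proof.
move=> E; have [g [[g1 _] gV _]] := Alt_universal triv_in triv_ext_alternative.
have := congr1 g E; rewrite !linearD !linearZ g1 !gV => -[].
rewrite /= !addr0 !scaler0 !add0r /GRing.scale /= !mulr1.
by split.
Qed.

End TrivialExtension.

Section Kingdon.
Variables (F : fieldType) (V : vectType F) (B : {symmetric V}).
Local Notation i := (@alt_in F V).

Inductive kingdon_rel : Alt V -> Prop :=
| kingdon_quad u v : kingdon_rel (i u ** i v + i v ** i u - B u v *: \1)
| kingdon_tri u v w :
    kingdon_rel ((i u ** i v) ** i w - i w ** (i v ** i u)).

Definition kingdon : naAlgType F := na_quot kingdon_rel.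

End Kingdon.

(* F[a] is gen_subalgebra a. As it is commutative, its stability under the    *)
(* involutory anti-automorphism conja amounts to conja restricting to an      *)
(* automorphism of F[a]. The identity (X - a)(X - a^* ) = X^2 - T(a)X + N(a)   *)
(* in F[X] is the conjunction of trace_in_base and norm_in_base.              *)
HB.mixin Record NAAlgebra_isSymQuadratic (F : fieldType) A
    of NAAlgebra F A := {
  conja : A -> A;
  conja_is_linear : linear conja;
  conjaK : involutive conja;
  conjaM : forall x y : A, conja (x ** y) = conja y ** conja x;
  gen_subalgebra_comm : forall a x y : A,
    gen_subalgebra a x -> gen_subalgebra a y -> x ** y = y ** x;
  gen_subalgebra_conja : forall a x : A,
    gen_subalgebra a x -> gen_subalgebra a (conja x);
  trace_in_base : forall a : A, exists t : F, a + conja a = t *: \1;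
  norm_in_base : forall a : A, exists n : F, a ** conja a = n *: \1;
  trace1 : \1 + conja \1 = 2%:R *: (\1 : A);
  norm1 : \1 ** conja \1 = (\1 : A)
}.

#[short(type="symQuadType")]
HB.structure Definition SymQuadratic (F : fieldType) :=
  {A of NAAlgebra_isSymQuadratic F A & NAAlgebra F A}.

#[short(type="finSymQuadType")]
HB.structure Definition FinSymQuadratic (F : fieldType) :=
  {A of SymQuadratic F A & Vector F A}.

Section BaseField.
Variable F : fieldType.

HB.instance Definition _ := Lmodule_isNAAlgebra.Build F F^o
  (@mul1r F) (@mulr1 F) (@mulrDl F) (@mulrDr F)
  (fun c x y => esym (mulrA c x y)) (fun c x y => mulrCA x c y).

Fact base_id_is_linear : linear (id : F^o -> F^o). Proof. by []. Qed.
Fact base_comm (x y : F^o) : x ** y = y ** x. Proof. exact: mulrC. Qed.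

HB.instance Definition _ := NAAlgebra_isSymQuadratic.Build F F^o
  base_id_is_linear (fun => erefl) base_comm (fun _ x y _ _ => base_comm x y)
  (fun _ _ => id)
  (fun a => ex_intro _ (a + a) (esym (mulr1 (a + a))))
  (fun a => ex_intro _ (a * a) (esym (mulr1 (a * a))))
  (esym (mulr1 2%:R))
  (mulr1 1).

End BaseField.

Definition cd_double (F : fieldType) (A : symQuadType F) (g : F) : Type :=
  (A * A)%type.

Section Double.
Variables (F : fieldType) (A : symQuadType F) (g : F).
Local Notation D := (cd_double A g).
Local Notation "x ^j" := (conja x) (at level 2, format "x ^j").

HB.instance Definition _ := GRing.Lmodule.copy D (A * A)%type.

Fact conjaD (x y : A) : (x + y)^j = x^j + y^j.
Proof. by rewrite -[x]scale1r conja_is_linear !scale1r. Qed.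
Fact conja0 : (0 : A)^j = 0.
Proof. by apply: (addrI (0 : A)^j); rewrite -conjaD !addr0. Qed.
Fact conjaZ (c : F) (x : A) : (c *: x)^j = c *: x^j.
Proof. by rewrite -[c *: x]addr0 conja_is_linear conja0 addr0. Qed.
Fact conjaN (x : A) : (- x)^j = - x^j.
Proof. by rewrite -!scaleN1r conjaZ. Qed.
Fact conja1 : (\1 : A)^j = \1.
Proof. by rewrite -[LHS]namul1l norm1. Qed.

Definition cd_mul (x y : D) : D :=
  (x.1 ** y.1 + g *: (y.2^j ** x.2), y.2 ** x.1 + x.2 ** y.1^j).

Definition cd_conj (x : D) : D := (x.1^j, - x.2).

Fact cd_mul1l : left_id ((\1, 0) : D) cd_mul.
Proof.
move=> [a b]; rewrite /cd_mul /=.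
by rewrite !namul1l namul1r namul0r namul0l scaler0 !addr0.
Qed.
Fact cd_mul1r : right_id ((\1, 0) : D) cd_mul.
Proof.
move=> [a b]; rewrite /cd_mul /=.
by rewrite conja0 conja1 !namul1r !namul0l scaler0 addr0 add0r.
Qed.
Fact cd_mulDl : left_distributive cd_mul +%R.
Proof.
move=> [a b] [c d] [e f]; congr (_, _) => /=.
  by rewrite namulDl namulDr scalerDr addrACA.
by rewrite namulDl namulDr addrACA.
Qed.
Fact cd_mulDr : right_distributive cd_mul +%R.
Proof.
move=> [a b] [c d] [e f]; congr (_, _) => /=.
  by rewrite conjaD namulDl namulDr scalerDr addrACA.
by rewrite conjaD namulDl namulDr addrACA.
Qed.
Fact cd_mulZl (k : F) (x y : D) : cd_mul (k *: x) y = k *: cd_mul x y.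
Proof.
case: x y => [a b] [c d]; congr (_, _) => /=.
  by rewrite namulZl namulZr scalerDr !scalerA mulrC.
by rewrite namulZl namulZr scalerDr.
Qed.
Fact cd_mulZr (k : F) (x y : D) : cd_mul x (k *: y) = k *: cd_mul x y.
Proof.
case: x y => [a b] [c d]; congr (_, _) => /=.
  by rewrite conjaZ namulZl namulZr scalerDr !scalerA mulrC.
by rewrite conjaZ namulZl namulZr scalerDr.
Qed.

HB.instance Definition _ := Lmodule_isNAAlgebra.Build F D
  cd_mul1l cd_mul1r cd_mulDl cd_mulDr cd_mulZl cd_mulZr.

Fact cd_conj_is_linear : linear cd_conj.
Proof.
move=> k [a b] [c d]; congr (_, _) => /=; first exact: conja_is_linear.
by rewrite opprD scalerN.
Qed.
Fact cd_conjK : involutive cd_conj.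
Proof. by move=> [a b]; rewrite /cd_conj /= conjaK opprK. Qed.
Fact cd_conjM (x y : D) : cd_conj (x ** y) = cd_conj y ** cd_conj x.
Proof.
case: x y => [a b] [c d]; congr (_, _) => /=.
  by rewrite conjaD conjaZ !conjaM !conjaN namulNl namulNr opprK conjaK.
by rewrite conjaK opprD !namulNl addrC.
Qed.

Lemma gen_subalgebra_self (a : A) : gen_subalgebra a a.
Proof. by move=> S _. Qed.

Fact conja_comm (a : A) : a^j ** a = a ** a^j.
Proof.
apply: (@gen_subalgebra_comm _ _ a).
  by apply: gen_subalgebra_conja; apply: gen_subalgebra_self.
exact: gen_subalgebra_self.
Qed.

Fact cd_trace_in_base (x : D) : exists t : F, x + cd_conj x = t *: \1.
Proof.
case: x => a b; have [t Et] := trace_in_base a; exists t.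
by congr (_, _); rewrite /= ?Et ?subrr ?scaler0.
Qed.
Fact cd_norm_in_base (x : D) : exists n : F, x ** cd_conj x = n *: \1.
Proof.
case: x => a b; have [n En] := norm_in_base a; have [m Em] := norm_in_base b.
exists (n - g * m); congr (_, _) => /=.
  by rewrite conjaN namulNl conja_comm En Em scalerN scalerA scalerBl.
by rewrite conjaK namulNl addNr scaler0.
Qed.

Fact cd_conj1 : cd_conj \1 = \1.
Proof. by congr (_, _); rewrite /= ?conja1 ?oppr0. Qed.
Fact cd_trace1 : \1 + cd_conj \1 = 2%:R *: (\1 : D).
Proof. by rewrite cd_conj1 scaler_nat mulr2n. Qed.
Fact cd_norm1 : \1 ** cd_conj \1 = (\1 : D).
Proof. by rewrite cd_conj1 namul1l. Qed.

(* F[x] is spanned by 1 and x. *)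
Fact cd_gen_subalgebra (x y : D) :
  gen_subalgebra x y -> exists p q : F, y = p *: \1 + q *: x.
Proof.
move=> /(_ (fun y => exists p q : F, y = p *: \1 + q *: x)); apply; last first.
  by exists 0, 1; rewrite scale0r add0r scale1r.
split.
- by exists 1, 0; rewrite scale0r addr0 scale1r.
- move=> _ _ [p [q ->]] [p' [q' ->]]; exists (p + p'), (q + q').
  by rewrite !scalerDl addrACA.
- move=> c _ [p [q ->]]; exists (c * p), (c * q).
  by rewrite scalerDr !scalerA.
- move=> _ _ [p [q ->]] [p' [q' ->]].
  have [t Et] := cd_trace_in_base x; have [n En] := cd_norm_in_base x.
  have Exx : x ** x = t *: x - n *: \1.
    rewrite -En -[x in t *: x](namul1r x) -namulZr -Et namulDr.
    by rewrite addrK.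
  exists (p * p' - q * q' * n), (p * q' + q * p' + q * q' * t).
  rewrite namulDl !namulDr !namulZl !namulZr !namul1l !namul1r Exx.
  rewrite scalerBr !scalerA scalerBl !scalerDl scalerBr !scalerA.
  by rewrite [RHS]addrAC !addrA !mulrA.
Qed.

Fact cd_gen_comm (a x y : D) :
  gen_subalgebra a x -> gen_subalgebra a y -> x ** y = y ** x.
Proof.
move=> /cd_gen_subalgebra[p [q ->]] /cd_gen_subalgebra[p' [q' ->]].
rewrite !namulDl !namulDr !namulZl !namulZr !namul1l !namul1r !scalerA.
by rewrite (mulrC p' p) (mulrC q' q) (mulrC q' p) (mulrC p' q) addrACA.
Qed.

Fact cd_gen_conj (a x : D) :
  gen_subalgebra a x -> gen_subalgebra a (cd_conj x).
Proof.
move=> ax S HS Sa; have Sx := ax S HS Sa; have [S1 SD SZ _] := HS.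
have [t Et] := cd_trace_in_base x.
have -> : cd_conj x = t *: \1 + (-1) *: x by rewrite -Et scaleN1r addrAC subrr add0r.
by apply: SD; apply: SZ.
Qed.

HB.instance Definition _ := NAAlgebra_isSymQuadratic.Build F D
  cd_conj_is_linear cd_conjK cd_conjM cd_gen_comm cd_gen_conj
  cd_trace_in_base cd_norm_in_base cd_trace1 cd_norm1.

End Double.

HB.instance Definition _ (F : fieldType) (A : finSymQuadType F) (g : F) :=
  Vector.copy (cd_double A g) (A * A)%type.

(* The process is applied with the last parameter of the list first. *)
Fixpoint cayley_dickson (F : fieldType) (gs : seq F) : finSymQuadType F :=
  if gs is g :: gs' then cd_double (cayley_dickson gs') g else F^o.

(* Main.v *)
(** Doubling an algebra A into A^g is universal for alternative targets: a
   morphism f from A to an alternative algebra K, together with v in K such that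
   v v = g and f(a) v = v f(a^* ), extends to a morphism A^g -> K sending (0, 1)
   to v. Take an orthogonal basis e_0, e_1, e_2 of V and g_i = B(e_i, e_i) / 2.
   In the Kingdon algebra K the e_i anticommute, and
   (e_0 e_1) e_2 = e_2 (e_1 e_0) = - e_2 (e_0 e_1); this is exactly what is
   needed to extend F -> K three times, to a morphism F^{g_0, g_1, g_2} -> K.
   Conversely F^{g_0, g_1, g_2} is alternative and contains a copy of V on which
   the defining relations of K hold, which gives a morphism in the other
   direction. The two are inverse to each other since they agree on generators. *)
From HB Require Import structures.
Require Import Defs.
From mathcomp Require Import all_boot all_algebra.
From mathcomp Require Import ring.

Set Implicit Arguments.
Unset Strict Implicit.
Unset Printing Implicit Defensive.

Import GRing.Theory.
Local Open Scope ring_scope.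

Lemma sum_ord3 (M : nmodType) (f : 'I_3 -> M) :
  \sum_(i < 3) f i = f 0 + f 1 + f 2%:R.
Proof.
rewrite !big_ord_recl big_ord0 addr0 addrA.
by congr (_ + f _ + f _); apply: val_inj.
Qed.

(** * Orthogonal bases for a possibly degenerate form *)

Section OrthogonalBasis.
Variables (F : fieldType) (F2 : (2%:R : F) \is a GRing.unit).
Variables (V : vectType F) (B : {symmetric V}).

Lemma symC u v : B u v = B v u.
Proof. by rewrite hermC /= expr0 mul1r. Qed.

Lemma sym_polar u v : B (u + v) (u + v) = B u u + B v v + 2%:R * B u v.
Proof.
rewrite linearDl !linearDr /=.
by rewrite -/(B v u) (symC v u); ring.
Qed.

(** Induction on [\dim U]. If [B] vanishes on [U], any basis works. Otherwise some [u] in [U] has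
    [B u u != 0], so [U] is the direct sum of the line of [u] and of its orthogonal inside [U],
    whose dimension is one less. *)
Lemma orthogonal_basis (U : {vspace V}) :
  exists X : seq V, basis_of U X /\ pairwise (fun u v => B u v == 0) X.
Proof.
have [n] := ubnP (\dim U); elim: n U => // n IH U leUn.
have [UU0|] := boolP (U <= orthov B U)%VS.
  exists (vbasis U); split; first exact: vbasisP.
  move/orthovP: UU0 => UU0; apply/(pairwiseP 0) => i j ltiU ltjU _.
  by apply/eqP/UU0; apply/vbasis_mem/mem_nth.
move=> UU; have [u Uu Buu] : exists2 u, u \in U & B u u != 0.
  case/subvPn: UU => u Uu /mem_orthovPn[v Uv Buv].
  have [u0|] := eqVneq (B u u) 0; last by exists u.
  have [v0|] := eqVneq (B v v) 0; last by exists v.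
  (* When both squares vanish, polarization gives [B (u + v) (u + v) = 2 B u v], which is nonzero
     because 2 is invertible. *)
  exists (u + v); first exact: memvD.
  by rewrite sym_polar u0 v0 !add0r mulf_neq0 // -unitfE.
set W := (U :&: orthov B <[u]>)%VS.
have dimW : (\dim U).-1 = \dim W.
  by apply: eq_dim_orthov1; apply/mem_orthovPn; exists u.
have u0 : u != 0 by apply: contraNneq Buu => ->; rewrite linear0l.
have dimU : (0 < \dim U)%N.
  by rewrite lt0n dimv_eq0; apply: contraNneq u0 => U0; rewrite -memv0 -U0.
have [|X [bX oX]] := IH W; first by rewrite -dimW -ltnS prednK.
have dir : directv (<[u]> + W).
  apply/directv_addP/eqP; rewrite -subv0; apply/subvP => x.
  rewrite !memv_cap => /and3P[/vlineP[k ->] _]; rewrite mem_orthov1 linearZl_LR /=.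
  by rewrite mulf_eq0 (negPf Buu) orbF => /eqP ->; rewrite scale0r mem0v.
exists (u :: X); split; last first.
  rewrite /= oX andbT; apply/allP => x /(basis_mem bX); rewrite memv_cap mem_orthov1.
  by case/andP => _; rewrite symC.
have -> : U = (<[u]> + W)%VS.
  apply/eqP; rewrite eq_sym eqEdim subv_add -memvE Uu capvSl /=.
  by rewrite (directvP dir) /= dim_vline u0 -dimW add1n prednK.
by rewrite -cat1s; apply: cat_basis => //; apply: seq1_basis.
Qed.

End OrthogonalBasis.

(** * Linearized alternative laws *)

Section Alternative.
Variables (F : fieldType) (K : naAlgType F) (altK : alternative K).
Implicit Types x y z : K.

Lemma altl_linearized x y z : x ** (y ** z) + y ** (x ** z) = (x ** y + y ** x) ** z.
Proof.
have := (altK (x + y) z).1; rewrite !(namulDl, namulDr) !(altK _ _).1 -!addrA.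
by move/addrI; rewrite !addrA => /addIr.
Qed.

Lemma altr_linearized x y z : (z ** x) ** y + (z ** y) ** x = z ** (x ** y + y ** x).
Proof.
have := (altK (x + y) z).2; rewrite !(namulDl, namulDr) !(altK _ _).2 -!addrA.
by move/addrI; rewrite !addrA => /addIr E; rewrite addrC -E addrC.
Qed.

End Alternative.

(** * Algebraic laws and universal property of the doubling *)

Section Doubling.
Variables (F : fieldType) (A : symQuadType F) (g : F).
Local Notation D := (cd_double A g).
Implicit Types a b c d : A.

Lemma cd_namulC (AC : commutative (@namul F A)) (Aj : forall a, conja a = a) :
  commutative (@namul F D).
Proof.
move=> [a b] [c d]; congr (_, _) => /=; rewrite !Aj ?(AC a c) ?(AC d b) //.
by rewrite (AC d a) (AC b c) addrC.
Qed.

Lemma cd_namulA (AA : associative (@namul F A)) (AC : commutative (@namul F A)) :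
  associative (@namul F D).
Proof.
move=> [a b] [c d] [e f]; congr (_, _) => /=.
  rewrite conjaD !conjaM conjaK !(namulDl, namulDr, namulZl, namulZr, scalerDr) !AA.
  rewrite -!addrA; congr (_ + _).
  have -> : a ** conja f ** d = conja f ** d ** a by rewrite -AA AC.
  have -> : conja c ** conja f ** b = conja f ** b ** conja c by rewrite -AA AC.
  have -> : e ** conja d ** b = conja d ** b ** e by rewrite -AA AC.
  by rewrite addrA [RHS]addrC.
rewrite conjaD conjaZ !conjaM conjaK !(namulDl, namulDr, namulZl, namulZr) !AA.
have swap (x y z : A) : x ** y ** z = x ** z ** y by rewrite -!(AA x) (AC y).
rewrite (swap f c) (swap d) (swap b (conja e)).
rewrite (AC (b ** conja d)) (AC b (conja d)) AA -!addrA; congr (_ + _).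
by rewrite addrA addrC.
Qed.

(** By associativity of [A], the left law reduces to the fact that traces and norms are scalars,
    hence commute with everything. *)
Lemma cd_alternative (AA : associative (@namul F A)) : alternative D.
Proof.
have altl (x y : D) : x ** (x ** y) = (x ** x) ** y.
  case: x y => [a b] [c d].
  have [t Et] := trace_in_base a; have [n En] := norm_in_base b.
  have trC z : a ** z + conja a ** z = z ** a + z ** conja a.
    by rewrite -namulDl -namulDr Et namulZl namulZr namul1l namul1r.
  have nC z : z ** conja b ** b = n *: z.
    by rewrite -AA conja_comm En namulZr namul1r.
  congr (_, _) => /=.
    rewrite conjaD !conjaM conjaK !(namulDl, namulDr, namulZl, namulZr, scalerDr) !AA.
    rewrite -(AA a (conja d)) -(AA (conja a)) nC (conja_comm b) En namulZl namul1l.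
    rewrite -!addrA; congr (_ + _).
    by rewrite addrA -(scalerDr g (a ** _)) trC scalerDr addrC.
  rewrite conjaD conjaZ !conjaM conjaK !(namulDl, namulDr, namulZl, namulZr) !AA.
  rewrite nC En namulZl namul1l -!(AA b) -!addrA; congr (_ + _).
  by rewrite addrA -(namulDr b (_ ** a)) -trC namulDr addrC.
move=> x y; split=> //.
(* Conjugation reverses products, so it turns the right law into the left law for the conjugates. *)
apply: (can_inj (@conjaK _ _)).
by rewrite !conjaM altl.
Qed.

(** Multiplicativity of [h] amounts to the three product rules [mulfv], [mulvf] and [mulvv]. For
    each, one adds to both sides the right-hand side with one factor conjugated: one side then
    contains a trace, which is a scalar, and the other is evaluated by a linearized alternative
    law. *)
Lemma cd_universal (K : naAlgType F) (altK : alternative K) (f : {linear A -> K})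
    (v : K) : na_morphism f -> v ** v = g *: \1 ->
    (forall a, f a ** v = v ** f (conja a)) ->
  exists h : {linear D -> K},
    na_morphism h /\ forall a b, h (a, b) = f a + f b ** v.
Proof.
move=> [f1 fM] vv fv; pose h (x : D) : K := f x.1 + f x.2 ** v.
have h_lin : linear h.
  move=> k [a b] [c d]; rewrite /h /= !linearD !linearZ /=.
  by rewrite namulDl namulZl addrACA.
pose h' : {linear D -> K} := HB.pack h (GRing.isLinear.Build F D K *:%R h h_lin).
have fT a : exists2 t : F, a + conja a = t *: \1 & v ** f a + f a ** v = t *: v.
  have [t Et] := trace_in_base a; exists t => //.
  by rewrite fv -namulDr -(linearD f) Et linearZ f1 namulZr namul1r.
exists h'; split=> //; split=> [|[a b] [c d]]; rewrite /h' /= /h /=.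
  by rewrite linear0 namul0l addr0.
have mulfv (x y : A) : f x ** (f y ** v) = f (y ** x) ** v.
  have [t Et Ev] := fT x; apply: (addIr (f (y ** conja x) ** v)).
  rewrite -namulDl -(linearD f) -namulDr Et namulZr namul1r.
  rewrite linearZ namulZl [f y ** v]fv.
  have -> : f (y ** conja x) ** v = v ** (f x ** f (conja y)).
    by rewrite fv conjaM conjaK fM.
  by rewrite altl_linearized // addrC Ev namulZl.
have mulvf (x y : A) : (f x ** v) ** f y = f (x ** conja y) ** v.
  have [t Et Ev] := fT y; apply: (addIr (f (x ** y) ** v)).
  rewrite -namulDl -(linearD f) -namulDr (addrC (conja y)) Et namulZr.
  rewrite namul1r linearZ namulZl.
  by rewrite fM altr_linearized // Ev namulZr.
have mulvv (x y : A) : (f x ** v) ** (f y ** v) = g *: f (conja y ** x).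
  have [t Et Ev] := fT y; apply: (addIr (g *: f (y ** x))).
  (* This lets [g *: f (y ** x)] be written as [(f x ** (f y ** v)) ** v], the partner that
     [altr_linearized] needs. *)
  have sqv z : z ** v ** v = g *: z by rewrite -(altK v z).2 vv namulZr namul1r.
  rewrite -scalerDr -(linearD f) -namulDl (addrC (conja y)) Et namulZl.
  rewrite namul1l linearZ.
  rewrite -(sqv (f (y ** x))) -mulfv altr_linearized // sqv.
  rewrite fv (altK v _).1 vv namulZl namul1l -scalerDr -(linearD f).
  by rewrite (addrC (conja y)) Et linearZ f1 !namulZr namul1r.
rewrite !(namulDl, namulDr) mulfv mulvf mulvv linearD linearZ /= !fM linearD /= !fM.
by rewrite -!addrA; congr (_ + _); rewrite namulDl addrC -addrA.
Qed.

End Doubling.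

(** * Quotients by generated ideals *)

Section QuotientAlgebra.
Variables (F : fieldType) (A : naAlgType F) (S : A -> Prop).

Lemma quot_alternative : alternative A -> alternative (na_quot S).
Proof.
move=> altA x y; have [_ piM] := quot_pi_morphism S.
have [[a <-] [b <-]] := (quot_pi_surj x, quot_pi_surj y).
(* The arguments of piM are explicit because a product in na_quot S is itself, by
   unfolding, a value of quot_pi, so that -!piM rewrites too much. *)
rewrite -(piM a a) -(piM a b) -(piM b a) -(piM a (a ** b)) -(piM (a ** a) b).
by rewrite -(piM b (a ** a)) -(piM (b ** a) a) (altA a b).1 (altA a b).2.
Qed.

Lemma quot_universal (K : naAlgType F) (f : {linear A -> K}) :
    na_morphism f -> (forall s, S s -> f s = 0) ->
  exists h : {linear na_quot S -> K},
    na_morphism h /\ forall x, h (quot_pi S x) = f x.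
Proof.
move=> [f1 fM] fS; pose h (x : na_quot S) := f (quot_repr x).
have kerI : two_sided_ideal (fun x => f x = 0).
  split=> [|x y fx fy|c x fx|a x fx|a x fx].
  - exact: linear0.
  - by rewrite linearD fx fy addr0.
  - by rewrite linearZ /= fx scaler0.
  - by rewrite fM fx namul0r.
  - by rewrite fM fx namul0l.
have hE x : h (quot_pi S x) = f x.
  apply/subr0_eq; rewrite -linearB.
  by apply: (gen_ideal_min kerI fS); apply: quot_piK.
have [pi1 piM] := quot_pi_morphism S.
have h_lin : linear h.
  move=> c x y; rewrite -(quot_reprK x) -(quot_reprK y) -linearZ -linearD !hE.
  by rewrite linearD linearZ.
pose h' : {linear na_quot S -> K} :=
  HB.pack h (GRing.isLinear.Build F (na_quot S) K *:%R h h_lin).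
exists h'; split=> //; split=> [|x y] /=; first by rewrite -pi1 hE.
by rewrite -(quot_reprK x) -(quot_reprK y) -piM !hE.
Qed.

End QuotientAlgebra.

(** * Relations and universal property of the Kingdon algebra *)

Section Kingdon.
Variables (F : fieldType) (F2 : (2%:R : F) \is a GRing.unit).
Variables (V : vectType F) (B : {symmetric V}).
Local Notation K := (kingdon B).

Definition kingdon_in (v : V) : K := quot_pi (kingdon_rel B) (alt_in v).

Lemma kingdon_alternative : alternative K.
Proof. exact/quot_alternative/Alt_alternative. Qed.

Lemma kingdon_quadE u v :
  kingdon_in u ** kingdon_in v + kingdon_in v ** kingdon_in u = B u v *: \1.
Proof.
have [pi1 piM] := quot_pi_morphism (kingdon_rel B).
rewrite -[in RHS]pi1 -linearZ -!piM -linearD; apply/quot_piP.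
exact/gen_ideal_gen/kingdon_quad.
Qed.

Lemma kingdon_triE u v w :
  (kingdon_in u ** kingdon_in v) ** kingdon_in w =
  kingdon_in w ** (kingdon_in v ** kingdon_in u).
Proof.
have [_ piM] := quot_pi_morphism (kingdon_rel B).
rewrite /kingdon_in -(piM (alt_in u)) -(piM (alt_in v)) -(piM _ (alt_in w)).
rewrite -(piM (alt_in w)); apply/quot_piP.
exact/gen_ideal_gen/kingdon_tri.
Qed.

Lemma kingdon_sqr v : kingdon_in v ** kingdon_in v = (B v v / 2%:R) *: \1.
Proof.
have := kingdon_quadE v v; rewrite -mulr2n -scaler_nat.
move=> /(congr1 (GRing.scale 2%:R^-1)).
by rewrite !scalerA mulVr // scale1r mulrC.
Qed.

Lemma kingdon_anticomm u v : B u v = 0 ->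
  kingdon_in u ** kingdon_in v = - (kingdon_in v ** kingdon_in u).
Proof.
by move=> uv0; apply/eqP; rewrite -addr_eq0 kingdon_quadE uv0 scale0r.
Qed.

Lemma kingdon_universal (A : naAlgType F) (f : {linear V -> A}) :
    alternative A ->
    (forall u v, f u ** f v + f v ** f u = B u v *: \1) ->
    (forall u v w, (f u ** f v) ** f w = f w ** (f v ** f u)) ->
  exists h : {linear K -> A}, na_morphism h /\ forall v, h (kingdon_in v) = f v.
Proof.
move=> altA fquad ftri; have [g [[g1 gM] gV _]] := Alt_universal f altA.
have grel s : kingdon_rel B s -> g s = 0.
  case=> [u v|u v w].
    by rewrite linearB linearD linearZ !gM g1 !gV fquad subrr.
  by rewrite linearB !gM !gV ftri subrr.
have [h [hM hE]] := quot_universal (conj g1 gM) grel.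
by exists h; split=> // v; rewrite hE gV.
Qed.

(** Composed with the projection from [Alt V], both [h] and the identity lift the same linear map on
    [V], so they agree by uniqueness of lifts. *)
Lemma kingdon_endo_id (h : {linear K -> K}) :
  na_morphism h -> (forall v, h (kingdon_in v) = kingdon_in v) -> h =1 id.
Proof.
move=> [h1 hM] hV x; rewrite -(quot_reprK x).
have [pi1 piM] := quot_pi_morphism (kingdon_rel B).
pose p : {linear Alt V -> K} := quot_pi (kingdon_rel B).
pose i : {linear V -> K} := p \o @alt_in F V.
rewrite -[LHS]/((h \o p) _) -[RHS]/(p _).
rewrite (@alt_lift_uniq _ _ _ kingdon_alternative i (h \o p)) //.
  by rewrite (@alt_lift_uniq _ _ _ kingdon_alternative i p).
by split=> [|y z] /=; rewrite ?pi1 ?h1 ?piM ?hM.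
Qed.

End Kingdon.

(** * Linear maps satisfying the Kingdon relations *)

Section KingdonMaps.
Variables (F : fieldType) (V : lmodType F).

(* The condition on conja makes this notion stable under doubling. *)
Definition kingdon_map (A : symQuadType F) (b : V -> V -> F) (f : V -> A) :=
  [/\ linear f, forall u, conja (f u) = - f u,
      forall u v, f u ** f v + f v ** f u = b u v *: \1 &
      forall u v w, (f u ** f v) ** f w = f w ** (f v ** f u)].

Lemma kingdon_map0 : kingdon_map (fun _ _ => 0) (fun _ => 0 : F^o).
Proof.
split=> [c u v|u|u v|u v w].
- by rewrite scaler0 addr0.
- by rewrite conja0 oppr0.
- by rewrite namul0l addr0 scale0r.
- by rewrite namul0r namul0l.
Qed.

Lemma cd_inlD (A : symQuadType F) (g : F) (a b : A) :
  ((a, 0) + (b, 0) : cd_double A g) = (a + b, 0).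
Proof. by congr (_, _); rewrite /= addr0. Qed.

Lemma cd_inlM (A : symQuadType F) (g : F) (a b : A) :
  ((a, 0) : cd_double A g) ** ((b, 0) : cd_double A g) = (a ** b, 0).
Proof. by congr (_, _); rewrite /= ?namul0l ?namul0r ?scaler0 ?addr0. Qed.

Lemma cd_inl_inr (A : symQuadType F) (g : F) (a b : A) :
  ((a, 0) : cd_double A g) + ((b, 0) : cd_double A g) ** ((0, \1) : cd_double A g) =
  (a, b).
Proof.
congr (_, _); rewrite /= ?conja0 ?namul0r ?namul0l ?namul1l ?scaler0 ?addr0 //.
by rewrite add0r.
Qed.

(** Each doubling adds a rank-one term to the form, so a diagonalized form is realized by doubling
    once per basis vector, starting from [kingdon_map0]. *)
Lemma kingdon_map_double (A : symQuadType F) (g : F) (b : V -> V -> F)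
    (f : V -> A) (l : {scalar V}) : kingdon_map b f ->
  kingdon_map (fun u v => b u v + 2%:R * g * (l u * l v))
    (fun u => (f u, l u *: (\1 : A)) : cd_double A g).
Proof.
move=> [flin fj fquad ftri].
have stepM u v : ((f u, l u *: (\1 : A)) : cd_double A g) **
      ((f v, l v *: (\1 : A)) : cd_double A g) =
    (f u ** f v + (g * (l u * l v)) *: \1, l v *: f u - l u *: f v).
  congr (_, _) => /=.
    by rewrite conjaZ conja1 namulZl namulZr namul1l !scalerA (mulrC (l v)).
  by rewrite !namulZl !namul1l fj scalerN.
split=> [c u v|u|u v|u v w].
- by congr (_, _) => /=; rewrite ?flin // linearP /= scalerDl scalerA.
- by congr (_, _) => /=; rewrite fj.
- rewrite !stepM; congr (_, _) => /=; last first.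
    (* The second component in [stepM] is antisymmetric in [u] and [v]. *)
    by rewrite -[X in _ + X]opprB subrr scaler0.
  rewrite addrACA fquad (mulrC (l v)) -!scalerDl; congr (_ *: _); ring.
- rewrite !stepM; congr (_, _) => /=.
    rewrite !conjaD !conjaN !conjaZ !fj conja1 !namulDl !namulDr !namulNl ftri.
    rewrite !namulZl !namulZr !namul1l !namul1r (mulrC (l v)) -!addrA.
    rewrite !scalerN opprK !scalerA !(mulrC (l w)).
    by rewrite [X in _ = _ + (_ + _ *: X)]addrC.
  rewrite !conjaD !conjaZ conja1 conjaM !fj.
  rewrite !(namulDl, namulDr, namulNl, namulNr) !namulZl !namulZr !namul1l.
  by rewrite (mulrC (l v)) !opprK addrC; congr (_ + _); apply: addrC.
Qed.

End KingdonMaps.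

(** * Passing from one extension to the next *)

Section Extension.
Variables (F : fieldType) (A : symQuadType F) (g : F) (K : naAlgType F).

(** Provides, for the next generator [w], the commutation hypothesis that [cd_universal] needs on
    the doubled algebra. *)
Lemma cd_universal_anticomm (f : {linear A -> K}) (v w : K)
    (h : {linear cd_double A g -> K}) :
    (forall a b, h (a, b) = f a + f b ** v) ->
    (forall a, f a ** w = w ** f (conja a)) ->
    (forall b, (f b ** v) ** w = - (w ** (f b ** v))) ->
  forall x, h x ** w = w ** h (conja x).
Proof.
move=> hE fw fvw [a b].
have -> : conja ((a, b) : cd_double A g) = (conja a, - b) by [].
by rewrite !hE namulDl namulDr fw fvw linearN namulNl namulNr.
Qed.

End Extension.

(** * The two inverse morphisms *)

Section Isomorphism.
Variables (F : fieldType) (F2 : (2%:R : F) \is a GRing.unit).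
Variables (V : vectType F) (B : {symmetric V}) (X : 3.-tuple V).
Hypothesis bX : basis_of fullv X.
Hypothesis oX : forall i j : 'I_3, i != j -> B X`_i X`_j = 0.

Local Notation K := (kingdon B).
Let g (i : 'I_3) : F := B X`_i X`_i / 2%:R.
Let A0 : symQuadType F := F^o.
Let A1 : symQuadType F := cd_double A0 (g 0).
Let A2 : symQuadType F := cd_double A1 (g 1).
Let A3 : symQuadType F := cd_double A2 (g 2%:R).
Let e (i : 'I_3) : K := kingdon_in B X`_i.

(** Each doubling loses one property: [A1] is commutative and associative since conjugation is
    trivial on [F], [A2] is still associative, and [A3] is alternative. *)
Lemma cd3_alternative : alternative A3.
Proof.
apply: cd_alternative; apply: cd_namulA.
  apply: cd_namulA; [exact: mulrA | exact: mulrC].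
by apply: cd_namulC; [exact: mulrC|].
Qed.

Lemma B_coord u v :
  B u v = \sum_(i < 3) 2%:R * g i * (coord X i u * coord X i v).
Proof.
rewrite {1}(coord_basis bX (memvf u)) {1}(coord_basis bX (memvf v)).
rewrite linear_sumlz; apply: eq_bigr => i _.
rewrite linear_sumr (bigD1 i) //= big1 ?addr0 => [|j ji].
  by rewrite linearZlr /= (mulrC 2%:R) divrK // mulrA mulrC.
by rewrite linearZlr /= oX ?mulr0 // eq_sym.
Qed.

Lemma kingdon_from_cd : exists h : {linear A3 -> K}, na_morphism h /\
  forall a b c d a' b' c' d' : F,
    h (((a, b), (c, d)), ((a', b'), (c', d'))) =
    (a *: \1 + b *: e 0 + (c *: \1 + d *: e 0) ** e 1) +
    (a' *: \1 + b' *: e 0 + (c' *: \1 + d' *: e 0) ** e 1) ** e 2%:R.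
Proof.
have altK := @kingdon_alternative _ _ B.
have anti (i j : 'I_3) : i != j -> e i ** e j = - (e j ** e i).
  by move=> ij; apply/kingdon_anticomm/oX.
have [f0 f0E] : exists f0 : {linear F^o -> K}, forall a : F, f0 a = a *: \1.
  have lin : linear (fun a : F^o => (a : F) *: (\1 : K)).
    by move=> c x y; rewrite scalerDl scalerA.
  pose f0 : {linear F^o -> K} :=
    HB.pack (fun a : F^o => (a : F) *: (\1 : K))
      (GRing.isLinear.Build F F^o K *:%R _ lin).
  by exists f0.
have f0M : na_morphism f0.
  by split=> [|a b]; rewrite !f0E ?scale1r // namulZl namul1l scalerA.
have f0w w a : f0 a ** w = w ** f0 (conja a).
  by rewrite !f0E namulZl namulZr namul1l namul1r.
have f0e (b : F) i : f0 b ** e i = b *: e i by rewrite f0E namulZl namul1l.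
have [h1 [h1M h1E]] := cd_universal altK f0M (kingdon_sqr F2 B _) (f0w (e 0)).
have h1w i : i != 0 -> forall x, h1 x ** e i = e i ** h1 (conja x).
  move=> i0; apply: (cd_universal_anticomm h1E (f0w _)) => b.
  by rewrite f0e namulZl namulZr anti 1?eq_sym // scalerN.
have [h2 [h2M h2E]] := cd_universal altK h1M (kingdon_sqr F2 B _) (h1w 1 isT).
have h2w : forall x, h2 x ** e 2%:R = e 2%:R ** h2 (conja x).
  apply: (cd_universal_anticomm h2E (h1w 2%:R isT)) => -[a b].
  rewrite h1E f0e f0E !(namulDl, namulDr) !(namulZl, namulZr) namul1l.
  (* The cubic relation enters here: it makes [e 2] anticommute with [e 0 ** e 1]. *)
  by rewrite kingdon_triE (anti 1 2%:R) // (anti 1 0) // namulNr !scalerN opprD.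
have [h3 [h3M h3E]] := cd_universal altK h2M (kingdon_sqr F2 B _) h2w.
exists h3; split=> // a b c d a' b' c' d'.
by rewrite h3E !h2E !h1E !f0e !f0E.
Qed.

(** The left side is the shape produced by iterating [kingdon_map_double]. *)
Lemma cd_of_vecE v : ((((0 : A0, coord X 0 v *: (\1 : A0)) : A1,
    coord X 1 v *: (\1 : A1)) : A2, coord X 2%:R v *: (\1 : A2)) : A3) =
  (((0, coord X 0 v), (coord X 1 v, 0)), ((coord X 2%:R v, 0), (0, 0))).
Proof.
by congr (((_, _), (_, _)), ((_, _), (_, _))); rewrite /= ?scaler0 //; apply: mulr1.
Qed.

Lemma kingdon_to_cd : exists h : {linear K -> A3}, na_morphism h /\
  forall v, h (kingdon_in B v) =
    (((0, coord X 0 v), (coord X 1 v, 0)), ((coord X 2%:R v, 0), (0, 0))).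
Proof.
pose i1 := kingdon_map_double (g 0) (coord X 0) (kingdon_map0 V).
pose i2 := kingdon_map_double (g 1) (coord X 1) i1.
have [f_lin _ fquad ftri] := kingdon_map_double (g 2%:R) (coord X 2%:R) i2.
pose f (v : V) : A3 := (((0 : A0, coord X 0 v *: (\1 : A0)) : A1,
    coord X 1 v *: (\1 : A1)) : A2, coord X 2%:R v *: (\1 : A2)).
pose f' : {linear V -> A3} := HB.pack f (GRing.isLinear.Build F V A3 *:%R f f_lin).
have f'quad u v : f' u ** f' v + f' v ** f' u = B u v *: \1.
  by rewrite [LHS]fquad B_coord sum_ord3 add0r.
have [h [hM hE]] := kingdon_universal cd3_alternative f'quad ftri.
by exists h; split=> // v; rewrite hE -cd_of_vecE.
Qed.

(** One composite fixes the generators of [K], so [kingdon_endo_id] applies; the other is computed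
    on the eight coordinates. *)
Lemma kingdon_cd_iso : na_isomorphic K A3.
Proof.
have [f [fM fE]] := kingdon_to_cd; have [h [hM hE]] := kingdon_from_cd.
have hfM : na_morphism (h \o f).
  by case: fM hM => f1 fM [h1 hM]; split=> [|y z] /=; rewrite ?f1 ?h1 ?fM ?hM.
exists f; split=> //; exists h => [x|].
  apply: (kingdon_endo_id hfM) => v /=.
  rewrite fE hE !scale0r !addr0 !add0r namul0l addr0 !namulZl !namul1l.
  rewrite [v in RHS](coord_basis bX (memvf v)) sum_ord3.
  by rewrite /e /kingdon_in !linearD !linearZ.
move=> [[[a b] [c d]] [[a' b'] [c' d']]]; rewrite hE.
have [f1 fMul] := fM.
have fe i : f (e i) =
    (((0, (0 == i)%:R), ((1 == i)%:R, 0)), (((2%:R == i)%:R, 0), (0, 0))).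
  by rewrite fE !coord_free ?(basis_free bX) // !(eq_sym i).
(* The coordinates are recovered one doubling at a time, using that [(a, b)] is [a] plus [b] times
   [(0, \1)]. *)
have f_lin0 (x y : F) : f (x *: \1 + y *: e 0) = (((x, y), 0), 0).
  rewrite linearD !linearZ f1 fe.
  congr (((_, _), _), _); rewrite /= ?scaler0 ?addr0 // ?add0r; apply: mulr1.
have f_lin1 (x y z t : F) :
    f (x *: \1 + y *: e 0 + (z *: \1 + t *: e 0) ** e 1) = (((x, y), (z, t)), 0).
  rewrite [LHS]linearD fMul !f_lin0 fe.
  by rewrite [X in _ + X]cd_inlM [LHS]cd_inlD; congr (_, _); apply: cd_inl_inr.
by rewrite linearD fMul !f_lin1 fe; apply: cd_inl_inr.
Qed.

End Isomorphism.

Theorem theorem4p9 (F : fieldType) (F2 : (2%:R : F) \is a GRing.unit)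
    (V : vectType F) (dimV : (\dim {:V} = 3)%N) (B : {symmetric V}) :
  exists gs : seq F,
    (\dim {: cayley_dickson gs} = 8)%N /\
    na_isomorphic (kingdon B) (cayley_dickson gs).
Proof.
have [X [bX oX]] := orthogonal_basis F2 B {:V}.
have sX : size X == 3 by rewrite -(size_basis (X := in_tuple X) bX) dimV.
have oXij (i j : 'I_3) : i != j -> B X`_i X`_j = 0.
  have sXi (k : 'I_3) : (k : nat) \in gtn (size X) by rewrite (eqP sX) inE ltn_ord.
  move: oX => /(pairwiseP 0) oX; rewrite neq_ltn => /orP[] ij.
    exact/eqP/oX.
  by rewrite symC; apply/eqP/oX.
(* The order is reversed because [cayley_dickson] doubles by the last parameter first. *)
exists [:: B X`_2%:R X`_2%:R / 2%:R; B X`_1 X`_1 / 2%:R; B X`_0 X`_0 / 2%:R].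
split; first by rewrite dimvf.
exact: (@kingdon_cd_iso F F2 V B (Tuple sX) bX oXij).
Qed.
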